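(* Let $T$ be a tree and let $f:T\to T$ be a continuous map such that no cut-point of $T$ is periodic under $f$. Then each $A\in\mathrm{Con}(T)$ is asymptotically periodic under $f$; that is, for each $A\in\mathrm{Con}(T)$ there is an integer $p\ge1$ such that the sequence $\{f^{pn}(A)\}_{n\ge0}$ converges in $\mathrm{Con}(T)$.
   Context: An interval is any space homeomorphic to $[0,1]\subset\mathbb{R}$. A tree is a (metrizable) uniquely arcwise connected space that is either a single point or a union of finitely many intervals. A point $x\in T$ is a cut-point of $T$ if $T\setminus\{x\}$ has more than one connected component. A point $x$ is periodic under $f$ if $f^k(x)=x$ for some $k\ge1$. A continuum is a nonempty compact connected metric space. $\mathrm{Con}(T)$ denotes the set of all subcontinua of $T$ (including singletons), endowed with the topology induced by the Hausdorff metric (for any compatible metric on $T$). *)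

(* Defs.v *)
From HB Require Import structures.
From mathcomp Require Import all_boot all_order all_algebra.
From mathcomp Require Import all_classical all_reals all_analysis.

Set Implicit Arguments.
Unset Strict Implicit.
Unset Printing Implicit Defensive.

Import Order.TTheory GRing.Theory Num.Theory.
Import numFieldNormedType.Exports.
Local Open Scope classical_set_scope.
Local Open Scope ring_scope.

(* [A] and [B] carry the subspace topologies; the values of [h] outside [A]
   and of [g] outside [B] are irrelevant. *)
Definition homeomorphism_on (X Y : topologicalType) (A : set X) (B : set Y)
    (h : X -> Y) : Prop :=
  exists g : Y -> X,
    [/\ {homo h : x / A x >-> B x}, {homo g : y / B y >-> A y},
        {in A, cancel h g} & {in B, cancel g h}] /\
    {within A, continuous h} /\ {within B, continuous g}.

Section Trees.
Context {R : realType} {T : metricType R}.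

Definition is_arc (I : set T) : Prop :=
  exists h : R -> T, @homeomorphism_on R T `[0, 1] I h.

Definition arc_between (x y : T) (I : set T) : Prop :=
  exists h : R -> T,
    [/\ @homeomorphism_on R T `[0, 1] I h, h 0 = x & h 1 = y].

End Trees.

Definition uniquely_arcwise_connected {R : realType} (T : metricType R) : Prop :=
  forall x y : T, x <> y -> exists! I : set T, arc_between x y I.

Definition tree {R : realType} (T : metricType R) : Prop :=
  uniquely_arcwise_connected T /\
  ((exists x : T, [set: T] = [set x]) \/
   (exists F : set (set T), [/\ F !=set0, finite_set F,
      (forall I, F I -> is_arc I) & [set: T] = \bigcup_(I in F) I])).

Definition cut_point {T : topologicalType} (x : T) : Prop :=
  exists y z : T, [/\ y <> x, z <> x &
    connected_component (~` [set x]) y <> connected_component (~` [set x]) z].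

Definition periodic_point {T : Type} (f : T -> T) (x : T) : Prop :=
  exists k : nat, (1 <= k)%N /\ iter k f x = x.

Definition continuum {T : topologicalType} (A : set T) : Prop :=
  [/\ A !=set0, compact A & connected A].

Record Con {R : realType} (T : metricType R) : Type := MkCon {
  con_set :> set T;
  con_continuum : continuum con_set }.

Section HausdorffMetric.
Context {R : realType} {T : metricType R}.
Implicit Types (A B C : set T) (X Y Z : Con T).

Definition thickening A (e : R) : set T := \bigcup_(a in A) ball a e.

Definition hausdorff_radii A B : set R :=
  [set e | [/\ 0 < e, A `<=` thickening B e & B `<=` thickening A e]].

(* For non-empty compact sets the infimum is over a non-empty set, so that the
   default value [inf set0 = 0] plays no role; see [hausdorff_radii_neq0]. *)
Definition hausdorff_dist A B : R := inf (hausdorff_radii A B).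

Lemma con_inj X Y : con_set X = con_set Y -> X = Y.
Proof.
case: X Y => [A cA] [B cB] /= AB; subst B; congr MkCon; exact: Prop_irrelevance.
Qed.

Lemma compact_in_ball A (b : T) : compact A ->
  \forall r \near +oo, A `<=` ball b r.
Proof.
move=> /compact_near_coveringP/(_ R +oo (fun r x => ball b r x)); apply.
move=> x Ax; exists (ball x 1, [set r | mdist b x + 1 < r]).
  split; first exact: nbhsx_ballx.
  by exists (mdist b x + 1); split => //; rewrite num_real.
move=> [y r] /= []; rewrite !ballEmdist /= => xy br.
rewrite (le_lt_trans (metric_triangle b x y))// (lt_trans _ br)//.
by rewrite ltrD2l.
Qed.

Lemma hausdorff_radii_neq0 X Y : hausdorff_radii X Y !=set0.
Proof.
have [[x Xx] cX _] := con_continuum X; have [[y Yy] cY _] := con_continuum Y.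
near (+oo : set_system R) => r; exists r; split.
- by near: r; exact: nbhs_pinfty_gt.
- move=> z Xz; exists y => //; move: z Xz.
  by near: r; exact: compact_in_ball.
- move=> z Yz; exists x => //; move: z Yz.
  by near: r; exact: compact_in_ball.
Unshelve. all: by end_near. Qed.

Lemma hausdorff_radii_lb A B : lbound (hausdorff_radii A B) 0.
Proof. by move=> e [/ltW]. Qed.

Lemma hausdorff_dist_le A B e : hausdorff_radii A B e -> hausdorff_dist A B <= e.
Proof.
by move=> h; apply: ge_inf => //; exists 0; exact: hausdorff_radii_lb.
Qed.

Lemma hausdorff_dist_ge0 X Y : 0 <= hausdorff_dist X Y.
Proof.
by apply: lb_le_inf; [exact: hausdorff_radii_neq0|exact: hausdorff_radii_lb].
Qed.

Lemma hausdorff_dist_lt X Y e : hausdorff_dist X Y < e ->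
  exists2 d, d < e & hausdorff_radii X Y d.
Proof.
move=> /(inf_lt _)[|d hd de]; last by exists d.
exact: hausdorff_radii_neq0.
Qed.

Lemma hausdorff_distxx X : hausdorff_dist X X = 0.
Proof.
apply/eqP; rewrite eq_le hausdorff_dist_ge0 andbT.
apply/ler_addgt0Pl => e e0; rewrite addr0; apply: hausdorff_dist_le.
by split => // x Xx; exists x => //; exact: ballxx.
Qed.

Lemma hausdorff_dist_sym X Y : hausdorff_dist X Y = hausdorff_dist Y X.
Proof.
by congr inf; apply/seteqP; split => e [? ? ?]; split.
Qed.

Lemma hausdorff_dist_triangle Y X Z :
  hausdorff_dist X Z <= hausdorff_dist X Y + hausdorff_dist Y Z.
Proof.
apply/ler_addgt0Pl => e e0; have e2 : 0 < e / 2 by rewrite divr_gt0.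
have [|d1 d1l [d10 XY YX]] := @hausdorff_dist_lt X Y (hausdorff_dist X Y + e / 2).
  by rewrite ltrDl.
have [|d2 d2l [d20 YZ ZY]] := @hausdorff_dist_lt Y Z (hausdorff_dist Y Z + e / 2).
  by rewrite ltrDl.
rewrite (@le_trans _ _ (d1 + d2))//; last first.
  by rewrite (le_trans (lerD (ltW d1l) (ltW d2l)))// addrACA -splitr addrC.
apply: hausdorff_dist_le; split; first exact: addr_gt0.
- move=> x /XY[y Yy yx]; have [z Zz zy] := YZ _ Yy; exists z => //.
  by rewrite addrC; exact: ball_triangle zy yx.
- move=> z /ZY[y Yy yz]; have [x Xx xy] := YX _ Yy; exists x => //.
  exact: ball_triangle xy yz.
Qed.

Lemma hausdorff_dist_sub X Y : hausdorff_dist X Y = 0 -> X `<=` Y.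
Proof.
move=> XY0 x Xx; have [_ cY _] := con_continuum Y.
have /closure_id -> := compact_closed (@metric_hausdorff _ T) cY.
move=> U /nbhs_ballP[e /= e0 xU].
have [|d de [_ /(_ x Xx)[y Yy yx] _]] := @hausdorff_dist_lt X Y e.
  by rewrite XY0.
by exists y; split => //; apply/xU/ball_sym/(le_ball (ltW de)).
Qed.

Lemma hausdorff_dist_positivity X Y : hausdorff_dist X Y = 0 -> X = Y.
Proof.
move=> XY0; apply/con_inj/seteqP; split; apply: hausdorff_dist_sub => //.
by rewrite hausdorff_dist_sym.
Qed.

HB.instance Definition _ := gen_eqMixin (Con T).
HB.instance Definition _ := gen_choiceMixin (Con T).
HB.instance Definition _ := @isMetric.Build R (Con T)
  (fun X Y => hausdorff_dist X Y) hausdorff_distxx hausdorff_dist_positivity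
  hausdorff_dist_sym hausdorff_dist_triangle.

End HausdorffMetric.

Section AsymptoticPeriodicity.
Context {R : realType} {T : metricType R}.

Lemma continuum_iter (f : T -> T) (n : nat) (A : set T) :
  continuous f -> continuum A -> continuum (iter n f @` A).
Proof.
move=> cf [[a Aa] cA kA]; have cn : continuous (iter n f).
  elim: n => [|n IH] x /=; first exact: cvg_id.
  by apply: continuous_comp; [exact: IH|exact: cf].
split; first by exists (iter n f a), a.
- by apply: continuous_compact => //; exact: continuous_subspaceT.
- by apply: connected_continuous_connected => //; exact: continuous_subspaceT.
Qed.

Definition con_iter (f : T -> T) (cf : continuous f) (n : nat) (A : Con T) :
    Con T :=
  MkCon (continuum_iter n cf (con_continuum A)).

Definition asymptotically_periodic (f : T -> T) (cf : continuous f)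
    (A : Con T) : Prop :=
  exists p : nat, (1 <= p)%N /\
    exists B : Con T, (fun n : nat => con_iter cf (p * n)%N A) @ \oo --> B.

End AsymptoticPeriodicity.

(* Main.v *)
Require Import Defs.
From mathcomp Require Import all_boot all_order all_algebra.
From mathcomp Require Import all_classical all_reals all_analysis.
From mathcomp Require Import lra.

Set Implicit Arguments.
Unset Strict Implicit.
Unset Printing Implicit Defensive.

Import Order.TTheory GRing.Theory Num.Theory.
Import numFieldNormedType.Exports.
Local Open Scope classical_set_scope.
Local Open Scope ring_scope.

(** Fix a root [a] of the tree and order its points by [x <=[a] y]: [x] lies on
    the arc from [a] to [y].  The points above a given [y] form a closed
    connected set whose only boundary point is [y], so that a connected set
    with points above [y] and points not above [y] contains [y]
    ([connected_cross]); finitely many tops dominate all points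
    ([finite_tops]); and a point that is neither the root nor maximal is a cut
    point ([inner_cut]).

    If [f] is the identity all sequences are constant; otherwise let [f] move
    [a].  Among the points [x] such that every [y] on the arc from [a] to [x]
    satisfies [y <=[a] f y], a maximal one, [e], is fixed
    ([exists_attracting]).  It is periodic, hence not a cut point, and
    near it the tree is a single arc, whose points are all moved towards [e].
    Root the tree at [e].  No inner point [y] satisfies [y <=[e] f^n y] with
    [n > 0]: otherwise the first point of the arc from [e] to [y], outside the
    neighbourhood just described, with [z <=[e] f^n z] would be a periodic cut
    point ([exists_root]).  Everything else follows from this
    non-return property.

    An orbit of inner points never climbs above one of its earlier terms, so it
    accumulates at a point only from beyond it, as seen from [e].  If it stayed
    away from [e], its limit points would be inner too; in a minimal closed
    invariant set of such points, a maximal point would be recurrent, hence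
    accumulated by points of the set beyond it, which is absurd.  So every
    orbit converges to [e] or falls on a periodic point, which is then [e] or a
    maximal point ([orbit_reaches]).  There are finitely many of those, and one
    iterate [g] of [f] fixes them all ([exists_common_period]).

    Let [A] be a continuum and [L] the set of points all of whose
    neighbourhoods meet [g^n A] for [n] large.  The continua [g^n A] converge
    to [L] as soon as they eventually enter each open set containing [L]
    ([cvg_lower_limit]), and by compactness this is a local question at each
    [a] in [A].  If the orbit of [a] tends to [e], nearby orbits do, and [e] is
    in [L].  If it ends at a fixed point [w] other than [e], then either some
    [g^j A] is reduced to [w], or it contains a small arc ending at [w].  The
    non-return property makes [g] expand this arc over itself
    ([expanding_end]); hence the images of the arc all lie in [L], and they
    contain the orbits that pass near [w]. *)

(** * Joining arcs *)

Section Arcs.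
Context {R : realType} {T : metricType R}.
Implicit Types (a b x y z : T) (O C : set T) (h k : R -> T) (s t u v : R).

Lemma closed_min (A : set R) u :
  closed A -> A !=set0 -> (forall s, A s -> u <= s) ->
  exists m, A m /\ forall s, A s -> m <= s.
Proof.
move=> cA A0 Au; exists (inf A); split.
  apply: cA => U /nbhs_ballP[e /= e0 eU].
  have [|s As slt] := inf_adherent e0 (_ : has_inf A).
    by split=> //; exists u.
  have is_ : inf A <= s by apply: ge_inf => //; exists u.
  exists s; split=> //; apply: eU; rewrite /ball/= ler0_norm ?subr_le0//.
  by rewrite opprB ltrBlDl.
by move=> s As; apply: ge_inf => //; exists u.
Qed.

Lemma image_segment_compact h s t :
  continuous h -> compact (h @` `[s, t]).
Proof.
move=> hc; apply: continuous_compact; last exact: segment_compact.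
exact: continuous_subspaceT.
Qed.

Lemma image_segment_closed h s t : continuous h -> closed (h @` `[s, t]).
Proof.
move=> hc; apply: compact_closed; first exact: metric_hausdorff.
exact: image_segment_compact.
Qed.

Lemma image_segment_connected h s t :
  continuous h -> connected (h @` `[s, t]).
Proof.
move=> hc; apply: connected_continuous_connected; first exact: segment_connected.
exact: continuous_subspaceT.
Qed.

Lemma closed_min_seg (A : set R) u v : 
  closed A -> A v -> u <= v -> exists m, [/\ u <= m, m <= v, A m
   & forall s, u <= s -> A s -> m <= s].
Proof.
move=> cA Av uv.
have [||s [_]|m [[Am um] mm]] := @closed_min (A `&` [set s | u <= s]) u.
- by apply: closedI => //; exact: closed_ge.
- by exists v.
- by [].
exists m; split => //; first by apply: mm.
by move=> s us As; apply: mm.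
Qed.

Definition arc_on h u v := [/\ u < v, continuous h
  & forall s t, u <= s <= v -> u <= t <= v -> h s = h t -> s = t].

Lemma arc_on_between h u v :
  arc_on h u v -> arc_between (h u) (h v) (h @` `[u, v]).
Proof.
move=> [uv hc hi].
pose r (t : R) := u + t * (v - u).
have rc : continuous r.
  move=> t; apply: cvgD; first exact: cvg_cst.
  by apply: cvgM; [exact: cvg_id|exact: cvg_cst].
have vu0 : 0 < v - u by rewrite subr_gt0.
have r01 t : 0 <= t <= 1 -> u <= r t <= v.
  move=> /andP[t0 t1]; rewrite /r; apply/andP; split; nra.
pose g (y : T) : R := xget 0 [set t | 0 <= t <= 1 /\ h (r t) = y].
have rK s : u <= s <= v -> exists2 t, 0 <= t <= 1 & r t = s.
  move=> /andP[us sv]; exists ((s - u) / (v - u)); last first.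
    by rewrite /r divfK ?gt_eqF// addrC subrK.
  by rewrite divr_ge0 ?subr_ge0 ?(ltW uv)//= ler_pdivrMr// mul1r lerD2r.
have hrK t : 0 <= t <= 1 -> g (h (r t)) = t.
  move=> t01; rewrite /g; case: xgetP => [s _ [s01 /hi]|/(_ t)/=]; last by case.
  move=> /(_ (r01 _ s01) (r01 _ t01)) /addrI /mulIf; apply.
  by rewrite gt_eqF.
exists (h \o r); split; last 2 first.
- by rewrite /r /= mul0r addr0.
- by rewrite /r /= mul1r addrC subrK.
have hrc : continuous (h \o r).
  by move=> t; apply: continuous_comp; [exact: rc|exact: hc].
exists g; split; [split|split].
- by move=> t /= ; rewrite in_itv/= => t01; exists (r t) => //=; rewrite in_itv/= r01.
- move=> y [s] /=; rewrite in_itv/= => /rK[t t01 <-] <-.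
  by rewrite hrK// in_itv.
- by move=> t; rewrite inE/= in_itv/= => t01; exact: hrK.
- move=> y; rewrite inE/= => -[s] /=; rewrite in_itv/= => /rK[t t01 <-] <-.
  by rewrite hrK.
- exact: continuous_subspaceT.
- apply/continuous_closedP => K cK; apply/closed_subspaceP.
  exists ((h \o r) @` (`[0, 1] `&` K)).
    apply: compact_closed; first exact: metric_hausdorff.
    apply: continuous_compact; first exact: continuous_subspaceT.
    by apply: compact_closedI => //; exact: segment_compact.
  apply/seteqP; split => y [].
    move=> [t [/=]]; rewrite in_itv/= => t01 Kt <- _.
    split; first by rewrite /preimage/= /from_subspace hrK.
    by exists (r t) => //; rewrite /= in_itv/= r01.
  rewrite /preimage/= /from_subspace => Kg [s].
  rewrite /= in_itv/= => /rK[t t01 <-] yE.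
  split; last by exists (r t) => //; rewrite /= in_itv/= r01.
  exists t => //; split; first by rewrite /= in_itv.
  by move: Kg; rewrite -yE hrK.
Qed.

(** Points joined inside [O] by an arc; reflexive by fiat, as an arc has two
    ends. *)
Definition linked O a b := O a /\ (a = b \/
  exists h u v, [/\ arc_on h u v, h u = a, h v = b & h @` `[u, v] `<=` O]).

Lemma arc_on_rev h u v : arc_on h u v -> arc_on (fun t => h (- t)) (- v) (- u).
Proof.
move=> [uv hc hi]; split; first by rewrite ltrN2.
  move=> t; apply: (@continuous_comp _ _ _ (@GRing.opp R) h); last exact: hc.
  exact: oppr_continuous.
move=> s t sv tv /hi E; apply: oppr_inj.
move: sv tv => /andP[vs su] /andP[vt tu].
by apply: E; rewrite lerNr lerNl ?su ?vs ?tu ?vt.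
Qed.

Lemma linked_sym O a b : linked O a b -> linked O b a.
Proof.
move=> [Oa [<-|[h [u [v [hA ha hb hO]]]]]]; first by split => //; left.
have [uv _ _] := hA.
split.
  by rewrite -hb; apply: hO; exists v => //; rewrite /= in_itv/= lexx ltW.
right.
exists (fun t => h (- t)), (- v), (- u).
split; rewrite /= ?opprK//; first exact: arc_on_rev.
move=> y [s /=]; rewrite in_itv/= => /andP[vs su] <-; apply: hO.
by exists (- s) => //; rewrite /= in_itv/= lerNr su lerNl.
Qed.

Lemma glue_continuous h k s : continuous h -> continuous k -> h s = k s ->
  continuous (fun t => if t <= s then h t else k t).
Proof.
move=> hc kc E; apply/continuous_closedP => C cC.
rewrite (_ : _ @^-1` _ = (h @^-1` C `&` [set t | t <= s]) `|`
                          (k @^-1` C `&` [set t | s <= t])).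
  apply: closedU; apply: closedI.
  - by move/continuous_closedP: hc; apply.
  - exact: closed_le.
  - by move/continuous_closedP: kc; apply.
  - exact: closed_ge.
apply/seteqP; split => t /=.
  by case: leP => ts; [left|right; rewrite ltW].
case=> -[Ct ts]; first by rewrite ts.
case: leP => // st; have -> : t = s by apply/eqP; rewrite eq_le ts st.
by rewrite E; move: Ct; have -> : t = s by apply/eqP; rewrite eq_le ts st.
Qed.

(** Following the first arc up to its first meeting with the second one keeps
    the concatenation injective. *)
Lemma linked_trans O b a c : linked O a b -> linked O b c -> linked O a c.
Proof.
move=> [Oa ab] [Ob bc]; split=> //.
case: ab => [->//|[h [u [v [hA ha hb hO]]]]].
case: bc => [<-|[k [u' [v' [kA kb kc kO]]]]].
  by right; exists h, u, v.
have [ac|ac] := pselect (a = c); [by left|right].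
have [uv hc hi] := hA; have [u'v' kc' ki] := kA.
have [|||s [us sv [t /=]]] := @closed_min_seg (h @^-1` (k @` `[u', v'])) u v.
- by move/continuous_closedP: hc; apply; exact: image_segment_closed.
- by exists u' => /=; rewrite ?in_itv/= ?lexx ?ltW// kb hb.
- exact: ltW.
rewrite in_itv/= => /andP[u't tv'] kt smin.
(* The first arc is left at parameter [s] and the second one entered at [t]. *)
pose w := s + (v' - t).
have uw : u < w.
  rewrite lt_neqAle; apply/andP; split; last by rewrite /w; lra.
  apply/eqP => uE; apply: ac.
  have sE : s = u by move: uE; rewrite /w; lra.
  have tE : t = v' by move: uE; rewrite /w; lra.
  by rewrite -ha -sE -kt tE.
pose k' r := k (t + (r - s)).
have k'c : continuous k'.
  move=> r; apply: continuous_comp; last exact: kc'.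
  apply: cvgD; first exact: cvg_cst.
  by apply: cvgB; [exact: cvg_id|exact: cvg_cst].
have sk' : h s = k' s by rewrite /k' subrr addr0.
exists (fun r => if r <= s then h r else k' r), u, w; split.
- split=> //; first exact: glue_continuous.
  have mix p q : u <= p -> p <= s -> s < q -> q <= w -> h p <> k' q.
    move=> up ps sq qw E.
    have sp : s <= p.
      apply: smin => //; exists (t + (q - s)); last exact: esym.
      by rewrite /= in_itv/=; move: qw; rewrite /w => qw; apply/andP; split; lra.
    have pE : p = s by apply/eqP; rewrite eq_le ps sp.
    move: E; rewrite pE -kt => /ki E.
    have : t = t + (q - s).
      by apply: E; move: qw; rewrite /w => qw; apply/andP; split; lra.
    lra.
  move=> p q /andP[up pw] /andP[uq qw]; case: leP => ps; case: leP => qs E.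
  - by apply: hi => //; apply/andP; split; lra.
  - by case: (mix p q).
  - by case: (mix q p).
  - move: pw qw; rewrite /w => pw qw.
    have : t + (p - s) = t + (q - s) by apply: ki => //; apply/andP; split; lra.
    lra.
- by rewrite us.
- case: leP => [ws|_].
    have tE : t = v' by move: ws; rewrite /w; lra.
    have -> : w = s by rewrite /w tE subrr addr0.
    by rewrite -kt tE.
  by rewrite /k' /w -kc; congr k; lra.
- move=> y [r /=]; rewrite in_itv/= => /andP[ur rw] <-; case: leP => rs.
    by apply: hO; exists r => //; rewrite /= in_itv/=; apply/andP; split; lra.
  apply: kO; exists (t + (r - s)) => //; rewrite /= in_itv/=.
  by move: rw; rewrite /w => rw; apply/andP; split; lra.
Qed.

End Arcs.

(** * Separation in a tree *)

Section ArcCover.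
Context {R : realType} {T : metricType R}.
Implicit Types (a b x y z : T) (O C : set T) (h k : R -> T) (s t u v : R).

Definition covered_by_arcs (n : nat) (h : nat -> R -> T) :=
  (forall i, (i < n)%N -> arc_on (h i) 0 1) /\
  forall x, exists i t, [/\ (i < n)%N, 0 <= t <= 1 & h i t = x].

Lemma near_ltn {X : Type} (F : set_system X) (P : nat -> X -> Prop) n :
  Filter F -> (forall i, (i < n)%N -> \forall x \near F, P i x) ->
  \forall x \near F, forall i, (i < n)%N -> P i x.
Proof.
move=> FF; elim: n => [_|n IH nP]; first by apply: nearW.
have Pn := nP n (ltnSn n).
have {}IH := IH (fun i ni => nP i (ltnW ni)).
near=> x => i; rewrite ltnS leq_eqVlt => /predU1P[->|]; first by near: x.
by move: i; near: x.
Unshelve. all: by end_near. Qed.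

(** The value outside the unit interval is frozen, so that arcs are globally
    continuous maps. *)
Lemma homeomorphism_on_arc (I : set T) h :
  @homeomorphism_on R T `[0, 1] I h -> exists k,
    [/\ arc_on k 0 1, k 0 = h 0, k 1 = h 1 & k @` `[0, 1] = I].
Proof.
move=> [g [[hI gI hK gK] [hc gc]]].
pose c (t : R) := Num.max 0 (Num.min t 1).
have c01 t : `[0, 1]%classic (c t).
  rewrite /= in_itv/= /c le_max lexx/= ge_max ler01/=.
  by rewrite ge_min lexx orbT.
have cE t : 0 <= t <= 1 -> c t = t.
  by move=> /andP[t0 t1]; rewrite /c min_l// max_r.
have cc : continuous c.
  move=> t; apply: (@continuous_max _ _ (cst 0) (fun t => Num.min t 1)).
    exact: cvg_cst.
  by apply: (@continuous_min _ _ id (cst 1)); [exact: cvg_id|exact: cvg_cst].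
exists (h \o c); split; [split => //| | |].
- move=> t U /= hU; move/subspace_continuousP: hc => /(_ _ (c01 t)) /(_ _ hU).
  have near_c V : nbhs (c t) V -> nbhs t (c @^-1` V) by exact: cc.
  move=> /near_c; apply: filterS => r /=; apply; exact: c01.
- move=> s t s01 t01 /=; rewrite !cE// => /(congr1 g).
  by rewrite !hK ?inE/= ?in_itv.
- by rewrite /= cE// lexx ler01.
- by rewrite /= cE// lexx ler01.
- apply/seteqP; split=> y.
    by move=> [t t01 <-]; apply: hI; exact: c01.
  move=> Iy; exists (g y); first exact: gI.
  by rewrite /= cE ?gK ?inE//; have := gI _ Iy; rewrite /= in_itv.
Qed.

Lemma tree_covered : tree T -> (exists x y : T, x <> y) ->
  exists n (h : nat -> R -> T), covered_by_arcs n h.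
Proof.
move=> [_ [[x0 T0]|[F [_ fF FA FT]]]] [x [y xy]].
  have h z : z = x0 by have : [set: T] z by []; rewrite T0.
  by case: xy; rewrite (h x) (h y).
have [l lF] := (@finite_seqP {classic (set T)} F).1 fF.
pose P (I : set T) h := arc_on h 0 1 /\ h @` `[0, 1] = I.
pose p I := xget (fun=> x) (P I).
have pP I : F I -> P I (p I).
  move=> /FA[h /homeomorphism_on_arc[k [kA _ _ kI]]].
  by apply: xgetPex; exists k.
exists (size l), (fun i => p (nth set0 l i)); split.
  move=> i il; have Fi : F (nth set0 l i) by rewrite lF /=; exact: mem_nth.
  by have [] := pP _ Fi.
move=> z; have : [set: T] z by [].
rewrite FT => -[I FI Iz].
have [_ pI] := pP I FI.
have Il : (I : {classic (set T)}) \in l by move: FI; rewrite lF.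
move: Iz; rewrite -pI => -[t /=]; rewrite in_itv/= => t01 tz.
exists (index (I : {classic (set T)}) l), t; split => //; first by rewrite index_mem.
by rewrite (@nth_index {classic (set T)} set0 I l).
Qed.

End ArcCover.

Section Linked.
Context {R : realType} {T : metricType R}.
Implicit Types (a b x y z : T) (O C : set T) (h k : R -> T) (s t u v : R).
Context (n : nat) (h : nat -> R -> T) (hcov : covered_by_arcs n h).

Lemma covered_compact : compact [set: T].
Proof.
have [hA hS] := hcov.
apply/compact_near_coveringP => I F P FF FP.
have : \forall j \near F, forall i, (i < n)%N -> h i @` `[0, 1] `<=` P j.
  apply: near_ltn => i /hA[_ hc _].
  have /compact_near_coveringP := @image_segment_compact _ _ (h i) 0 1 hc.
  by move=> /(_ I F P FF); apply => x _; exact: FP.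
apply: filterS => j jP x _.
have [i [t [ni t01 <-]]] := hS x; apply: (jP i ni).
by exists t => //=; rewrite in_itv.
Qed.

(** The tree is locally connected by arcs: the finitely many arcs of the cover
    that avoid the point are at a positive distance from it. *)
Lemma near_linked O x : open O -> O x -> \forall x' \near x, linked O x x'.
Proof.
move=> oO Ox; have [hA hS] := hcov.
have : \forall x' \near x, forall i, (i < n)%N ->
    (h i @` `[0, 1]) x' -> linked O x x'.
  apply: near_ltn => i /hA[_ {}hc hi].
  have [[s /= + sx]|hx] := pselect ((h i @` `[0, 1]) x); last first.
    have : nbhs x (~` (h i @` `[0, 1])).
      apply: open_nbhs_nbhs; split=> //; apply: closed_openC.
      exact: image_segment_closed.
    by apply: filterS => x' /[apply].
  rewrite in_itv/= => s01.
  have : nbhs s (h i @^-1` O).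
    by apply: hc; rewrite sx; apply: open_nbhs_nbhs.
  move=> /nbhs_ballP[e /= e0 eO].
  (* By injectivity the far part of the arc is a compact set missing [x]. *)
  pose K := h i @` (`[0, 1] `&` [set t | e <= `|s - t|]).
  have cK : closed K.
    apply: compact_closed; first exact: metric_hausdorff.
    apply: continuous_compact; first exact: continuous_subspaceT.
    apply: compact_closedI; first exact: segment_compact.
    apply: (@preimage_closed _ _ (fun t => `|s - t|) [set r | e <= r]).
      move=> t _; apply: cvg_norm.
      by apply: cvgB; [exact: cvg_cst|exact: cvg_id].
    exact: closed_ge.
  have nK : nbhs x (~` K).
    apply: open_nbhs_nbhs; split; first exact: closed_openC.
    move=> [t [/= + et]]; rewrite in_itv/= -sx => t01 /(hi _ _ t01 s01) ts.
    by move: et; rewrite ts subrr normr0 leNgt e0.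
  move: nK; apply: filterS => x' nKx' [t /= + tx']; rewrite in_itv/= => t01.
  have te : `|s - t| < e.
    rewrite ltNge; apply/negP => et; apply: nKx'.
    by exists t => //; split => //=; rewrite in_itv.
  have arc p q : 0 <= p <= 1 -> 0 <= q <= 1 -> `|s - p| < e -> `|s - q| < e ->
      p < q -> linked O (h i p) (h i q).
    move=> /andP[p0 p1] /andP[q0 q1]; rewrite !ltr_distlC.
    move=> /andP[pe ep] /andP[qe eq] pq; split.
      by apply: eO; rewrite /ball/= ltr_distlC pe.
    right; exists (h i), p, q; split => //.
      split=> // p' q' /andP[pp' pq'] /andP[qp' qq'] E.
      by apply: hi => //; apply/andP; split; lra.
    move=> y [r /=]; rewrite in_itv/= => /andP[pr rq] <-.
    by apply: eO; rewrite /ball/= ltr_distlC; apply/andP; split; lra.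
  have ss : `|s - s| < e by rewrite subrr normr0.
  rewrite -sx -tx'; case: (ltgtP s t) => [st|ts|->].
  - exact: arc.
  - by apply: linked_sym; exact: arc.
  - by split; [apply: eO; exact: te|left].
apply: filterS => x' H.
have [i [t [ni t01 tx]]] := hS x'; apply: (H i ni).
by exists t => //=; rewrite in_itv.
Qed.

(** The points linked to [a] inside [O] form a set that is open and closed
    in [O]. *)
Lemma connected_linked O C a b : open O -> connected C -> C `<=` O ->
  C a -> C b -> linked O a b.
Proof.
move=> oO kC CO Ca Cb.
have Oa := CO _ Ca.
suff : C `&` linked O a = C by move=> /seteqP[_ /(_ b Cb)[]].
apply: kC.
- by exists a; split => //; split => //; left.
- exists (linked O a) => //; rewrite openE => x ax.
  have Ox : O x by have [] := linked_sym ax.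
  have := near_linked oO Ox; apply: filterS => x'; exact: linked_trans.
- exists (~` (O `&` ~` linked O a)).
    apply: open_closedC; rewrite openE => x [Ox nax].
    have := near_linked oO Ox; apply: filterS => x' xx'; split.
      by have [] := linked_sym xx'.
    by move=> ax'; apply: nax; apply: linked_trans ax' _; exact: linked_sym.
  apply/seteqP; split => x [Cx ax]; split => //.
    by move=> [_]; exact.
  by apply: contrapT => nax; apply: ax; split => //; exact: CO.
Qed.

Context (hU : uniquely_arcwise_connected T).

(** A connected set avoiding a point of the arc would lie in an open set
    in which its points are joined by another arc. *)
Lemma arc_separates k u v s C : arc_on k u v -> u <= s <= v ->
  connected C -> C (k u) -> C (k v) -> C (k s).
Proof.
move=> kA suv kC Cu Cv; apply: contrapT => nCs.
have [uv kc ki] := kA.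
have oO : open (~` [set k s]).
  apply: closed_openC; apply: accessible_closed_set1.
  by apply: hausdorff_accessible; exact: metric_hausdorff.
have CO : C `<=` ~` [set k s] by move=> x Cx xs; apply: nCs; rewrite -xs.
have kuv : k u <> k v.
  move=> /ki E; move: (uv); rewrite E ?ltxx//; first by rewrite lexx ltW.
  by rewrite lexx ltW.
have [_ [/kuv//|[l [u' [v' [lA lu lv lO]]]]]] := connected_linked oO kC CO Cu Cv.
have [I [_ I1]] := hU kuv.
have E1 := I1 _ (arc_on_between kA).
have := arc_on_between lA; rewrite lu lv => /I1 E2.
by apply: (lO (k s)) => //; rewrite -E2 E1; exists s => //=; rewrite in_itv.
Qed.

End Linked.

(** * The order of a rooted tree *)

Reserved Notation "x <=[ a ] y" (at level 70, a at level 200, y at next level).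

Section RootedOrder.
Context {R : realType} {T : metricType R}.
Implicit Types (a b u v w x y z : T) (O C : set T) (k : R -> T) (s t : R).

Definition arc_tree := uniquely_arcwise_connected T /\
  exists n (h : nat -> R -> T), covered_by_arcs n h.

(** [x] lies on the arc from [a] to [y]; the quantification over connected sets
    makes the order laws and the intermediate value property formal. *)
Definition le_from a x y := forall C, connected C -> C a -> C y -> C x.
Local Notation "x <=[ a ] y" := (le_from a x y).

Lemma le_refl_from a x : x <=[a] x. Proof. by []. Qed.

Lemma le_trans_from a y x z : x <=[a] y -> y <=[a] z -> x <=[a] z.
Proof. by move=> xy yz C kC Ca Cz; apply: xy => //; apply: yz. Qed.

Lemma ge_root a x : a <=[a] x. Proof. by []. Qed.

Lemma le_root a x : x <=[a] a -> x = a.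
Proof. by move=> /(_ [set a]); apply => //; exact: connected1. Qed.

Lemma le_from_sym a b x : x <=[a] b -> x <=[b] a.
Proof. by move=> xb C kC Cb Ca; exact: xb. Qed.

Lemma not_le_from a y x :
  ~ y <=[a] x -> exists C, [/\ connected C, C a, C x & ~ C y].
Proof.
move=> yx; apply: contrapT => nC; apply: yx => C kC Ca Cx.
by apply: contrapT => Cy; apply: nC; exists C.
Qed.

(** The intermediate value property of the order. *)
Lemma connected_cross a C u v y :
  connected C -> C u -> C v -> y <=[a] u -> ~ y <=[a] v -> C y.
Proof.
move=> kC Cu Cv yu /not_le_from[D [kD Da Dv Dy]].
have [//|//] : (D `|` C) y.
by apply: yu; [apply: connectedU => //; exists v|left|right].
Qed.

Lemma cut_point_from a y x : y <> a -> x <> y -> y <=[a] x -> cut_point y.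
Proof.
move=> ya xy yx; exists a, x; split => //; first exact: nesym.
move=> E.
have Ka : connected_component (~` [set y]) a a.
  by apply: connected_component_refl => /= ay; apply: ya.
have Kx : connected_component (~` [set y]) a x.
  by rewrite E; apply: connected_component_refl.
have := yx _ (@component_connected _ (~` [set y]) a) Ka Kx.
by move=> /connected_component_sub /(_ erefl).
Qed.

Context (hT : arc_tree).

Lemma tree_compact : compact [set: T].
Proof. by have [_ [n [h hc]]] := hT; exact: covered_compact hc. Qed.

(** The order below [y] is that of a parametrization of the arc from the root;
    the local study of the order rests on the continuity of [k]. *)
Lemma arc_param a y : a <> y -> exists k,
  [/\ continuous k, k 0 = a, k 1 = y,
      forall s t, 0 <= s <= 1 -> 0 <= t <= 1 -> (k s <=[a] k t <-> s <= t) &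
      forall x, x <=[a] y -> exists2 t : R, 0 <= t <= 1 & k t = x].
Proof.
have [hU [n [h hc]]] := hT.
move=> /hU[I [[k0 [kI k00 k01]] _]].
have [k [kA k_0 k_1 _]] := homeomorphism_on_arc kI.
rewrite k00 in k_0; rewrite k01 in k_1; have [_ kc ki] := kA.
exists k; split=> //.
  move=> s t /andP[s0 s1] /andP[t0 t1]; split=> [st|st C kC Ca Ct].
    have [r] : (k @` `[0, t]) (k s).
      apply: st; first exact: image_segment_connected.
      - by exists 0 => //; rewrite /= in_itv/= lexx.
      - by exists t => //; rewrite /= in_itv/= lexx t0.
    rewrite /= in_itv/= => /andP[r0 rt] /ki <-//; first by rewrite r0 (le_trans rt).
    by rewrite s0.
  have [//|[r]] : (C `|` k @` `[t, 1]) (k s).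
    apply: (arc_separates hc hU kA); rewrite ?s0//.
    - apply: connectedU => //; last exact: image_segment_connected.
      by exists (k t); split => //; exists t => //; rewrite /= in_itv/= lexx.
    - by left; rewrite k_0.
    - by right; exists 1 => //; rewrite /= in_itv/= lexx t1.
  rewrite /= in_itv/= => /andP[tr r1] /ki rs.
  have E : r = s by apply: rs; apply/andP; split => //; exact: le_trans tr.
  by have -> : s = t by apply/eqP; rewrite eq_le st -E.
move=> x xy; have [t] : (k @` `[0, 1]) x.
  apply: xy; first exact: image_segment_connected.
  - by exists 0 => //; rewrite /= in_itv/= lexx ler01.
  - by exists 1 => //; rewrite /= in_itv/= lexx ler01.
by rewrite /= in_itv/= => t01 <-; exists t.
Qed.

Lemma le_anti_from a x y : x <=[a] y -> y <=[a] x -> x = y.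
Proof.
have [<-|/arc_param[k [kc k0 k1 kle kS]]] := pselect (a = y).
  by move=> /le_root.
move=> /kS[t t01 <-]; rewrite -k1 => /kle; rewrite lexx ler01 => /(_ erefl t01) t1.
by congr k; apply/eqP; rewrite eq_le t1; case/andP: t01 => _ ->.
Qed.

Lemma le_total_from a z x y :
  x <=[a] z -> y <=[a] z -> x <=[a] y \/ y <=[a] x.
Proof.
have [<-|/arc_param[k [kc k0 k1 kle kS]]] := pselect (a = z).
  by move=> /le_root -> _; left.
move=> /kS[s s01 <-] /kS[t t01 <-]; have [st|/ltW ts] := leP s t.
  by left; apply/kle.
by right; apply/kle.
Qed.

Lemma linked_connected O x y : linked O x y ->
  exists C, [/\ connected C, C x, C y & C `<=` O].
Proof.
move=> [Ox [<-|[k [u [v [[uv kc _] <- <- kO]]]]]].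
  by exists [set x]; split=> // [|z ->//]; exact: connected1.
exists (k @` `[u, v]); split=> //; first exact: image_segment_connected.
- by exists u => //; rewrite /= in_itv/= lexx ltW.
- by exists v => //; rewrite /= in_itv/= lexx ltW.
Qed.

Lemma near_connected O x : open O -> O x ->
  \forall x' \near x, exists C, [/\ connected C, C x, C x' & C `<=` O].
Proof.
move=> oO Ox; have [_ [n [h hc]]] := hT.
by have := near_linked hc oO Ox; apply: filterS => x'; exact: linked_connected.
Qed.

Lemma open_setC1 y : open (~` [set y]).
Proof.
apply: closed_openC; apply: accessible_closed_set1.
by apply: hausdorff_accessible; exact: metric_hausdorff.
Qed.

Lemma open_not_ge a y : open [set x | ~ y <=[a] x].
Proof.
rewrite openE => x yx; have [C [kC Ca Cx Cy]] := not_le_from yx.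
have yx' : (~` [set y]) x by move=> xy; apply: Cy; rewrite -xy.
have := near_connected (@open_setC1 y) yx'; apply: filterS.
move=> x' [D [kD Dx Dx' Dy]] /(_ (C `|` D)) [].
- by apply: connectedU => //; exists x.
- by left.
- by right.
- by move=> /Cy.
- by move=> /Dy /(_ erefl).
Qed.

Lemma closed_ge_from a y : closed [set x | y <=[a] x].
Proof.
rewrite (_ : [set x | _] = ~` [set x | ~ y <=[a] x]).
  by apply: open_closedC; exact: open_not_ge.
by apply/seteqP; split => x /=; [move=> ? /(_ _)|exact: contrapT].
Qed.

Lemma open_gt_from a y : open [set x | y <=[a] x /\ x <> y].
Proof.
rewrite openE => x [yx xy].
have := near_connected (@open_setC1 y) xy; apply: filterS.
move=> x' [D [kD Dx Dx' Dy]]; split; last by move: Dx' => /Dy.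
apply: contrapT => /(connected_cross kD Dx Dx' yx).
by move=> /Dy /(_ erefl).
Qed.

Lemma closed_le_from a y : closed [set x | x <=[a] y].
Proof.
have [<-|/arc_param[k [kc k0 k1 kle kS]]] := pselect (a = y).
  rewrite (_ : [set x | _] = [set a]).
    by rewrite -[X in closed X]setCK; apply: open_closedC; exact: open_setC1.
  by apply/seteqP; split => x /=; [exact: le_root|move->].
rewrite (_ : [set x | _] = k @` `[0, 1]); first exact: image_segment_closed.
apply/seteqP; split=> [x /kS[t t01 <-]|x].
  by exists t => //; rewrite /= in_itv.
move=> [t /=]; rewrite in_itv/= => t01 <-.
by rewrite -k1; apply/kle; rewrite ?ler01 ?lexx//; case/andP: t01.
Qed.

Lemma interval_connected a y x : connected [set z | y <=[a] z /\ z <=[a] x].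
Proof.
have [->|xa] := pselect (a = x).
  have [ya|ya] := pselect (y = x).
    rewrite (_ : [set z | _] = [set x]); first exact: connected1.
    apply/seteqP; split => z /=; first by move=> [_ /le_root].
    by move=> ->; rewrite ya; split.
  rewrite (_ : [set z | _] = set0); first exact: connected0.
  apply/seteqP; split => z //= -[yz /le_root zx].
  by move: yz; rewrite zx => /le_root.
have [k [kc k0 k1 kle kS]] := arc_param xa.
have [/kS[s s01 <-]|yx] := pselect (y <=[a] x); last first.
  rewrite (_ : [set z | _] = set0); first exact: connected0.
  apply/seteqP; split => z //= -[yz zx].
  by apply: yx; exact: le_trans_from zx.
rewrite (_ : [set z | _] = k @` `[s, 1]); first exact: image_segment_connected.
apply/seteqP; split=> z /=.
  move=> [+ /kS[t t01 tz]]; rewrite -tz => /(kle _ _ s01 t01) st.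
  by exists t => //; rewrite in_itv/= st; case/andP: t01.
move=> [t]; rewrite in_itv/= => /andP[st t1] <-.
have s0 : 0 <= s by case/andP: s01.
have t0 := le_trans s0 st.
by split; [|rewrite -k1]; apply/kle; rewrite ?t0 ?t1 ?lexx ?ler01.
Qed.

(** A union of arcs issued from [y]. *)
Lemma ge_connected a y : connected [set x | y <=[a] x].
Proof.
rewrite (_ : [set x | _] = \bigcup_(x in [set x | y <=[a] x])
    [set z | y <=[a] z /\ z <=[a] x]); last first.
  apply/seteqP; split=> [z yz|z [x _ []]//].
  by exists z => //; split => //; exact: le_refl_from.
apply: bigcup_connected => [|x _]; last exact: interval_connected.
by exists y => x yx; split => //; exact: le_refl_from.
Qed.

(** Every point of an arc of the cover lies below one of its two ends, for
    otherwise these ends could be joined through the root without meeting it. *)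
Lemma finite_tops a : exists l : seq T, forall x, exists2 v, v \in l & x <=[a] v.
Proof.
have [hU [n [h hc]]] := hT; have [hA hS] := hc.
exists ([seq h i 0 | i <- iota 0 n] ++ [seq h i 1 | i <- iota 0 n]) => x.
have [i [t [ni t01 <-]]] := hS x.
have ni' : i \in iota 0 n by rewrite mem_iota.
apply: contrapT => nv.
have [C [kC Ca C0 Cx]] : exists C, [/\ connected C, C a, C (h i 0) & ~ C (h i t)].
  apply: not_le_from => le0; apply: nv; exists (h i 0) => //.
  by rewrite mem_cat map_f.
have [D [kD Da D1 Dx]] : exists C, [/\ connected C, C a, C (h i 1) & ~ C (h i t)].
  apply: not_le_from => le1; apply: nv; exists (h i 1) => //.
  by rewrite mem_cat (map_f (fun i => h i 1)) ?orbT.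
have [//|//] : (C `|` D) (h i t).
apply: (arc_separates hc hU (hA i ni) t01); [|by left|by right].
by apply: connectedU => //; exists a.
Qed.

Lemma near_left a w O : w <> a -> open O -> O w -> exists u,
  [/\ u <=[a] w, u <> w & forall z, u <=[a] z -> z <=[a] w -> O z].
Proof.
move=> /nesym/arc_param[k [kc k0 k1 kle kS]] oO Ow.
have : nbhs (1 : R) (k @^-1` O) by apply: kc; rewrite k1; apply: open_nbhs_nbhs.
move=> /nbhs_ballP[e /= e0 eO].
pose s := Num.max 0 (1 - e / 2).
have s0 : 0 <= s by rewrite le_max lexx.
have s1 : s < 1 by rewrite gt_max ltr01/= gtrBl divr_gt0.
have s01 : 0 <= s <= 1 by rewrite s0 ltW.
have l01 : (0 : R) <= (1 : R) <= (1 : R) by rewrite ler01 lexx.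
exists (k s); split.
- by rewrite -k1; exact: (kle _ _ s01 l01).2 (ltW s1).
- rewrite -k1 => E; have : k 1 <=[a] k s by rewrite E; exact: le_refl_from.
  by move=> /(kle _ _ l01 s01); rewrite leNgt s1.
move=> z sz zw; have [t t01 tz] := kS z zw.
have st : s <= t by apply: (kle _ _ s01 t01).1; rewrite tz.
rewrite -tz; apply: eO; rewrite /ball/= ltr_distlC.
move: st; rewrite /s ge_max => /andP[t0 et].
by case/andP: t01 => _ t1; apply/andP; split; lra.
Qed.

Lemma near_right a w x O : w <=[a] x -> w <> x -> open O -> O w -> exists u,
  [/\ w <=[a] u, u <=[a] x, u <> w & forall z, w <=[a] z -> z <=[a] u -> O z].
Proof.
move=> wx wx'.
have ax : a <> x.
  by move=> ax; apply: wx'; rewrite -ax; apply: le_root; rewrite {2}ax.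
have [k [kc k0 k1 kle kS]] := arc_param ax.
have [s s01 sw] := kS w wx; rewrite -sw => oO Ow.
have : nbhs s (k @^-1` O) by apply: kc; apply: open_nbhs_nbhs.
move=> /nbhs_ballP[e /= e0 eO].
have s1 : s < 1.
  rewrite lt_neqAle; case/andP: (s01) => _ ->; rewrite andbT.
  by apply/eqP => s1; apply: wx'; rewrite -sw s1.
pose t := Num.min 1 (s + e / 2).
have st : s < t by rewrite lt_min s1 ltrDl divr_gt0.
have t1 : t <= 1 by rewrite ge_min lexx.
have t01 : 0 <= t <= 1 by rewrite t1 andbT; case/andP: s01 => s0 _; lra.
have l01 : (0 : R) <= (1 : R) <= (1 : R) by rewrite ler01 lexx.
exists (k t); split.
- exact: (kle _ _ s01 t01).2 (ltW st).
- by rewrite -k1; exact: (kle _ _ t01 l01).2 t1.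
- move=> E; have : k t <=[a] k s by rewrite E; exact: le_refl_from.
  by move=> /(kle _ _ t01 s01); rewrite leNgt st.
move=> z sz zt.
have zx : z <=[a] x.
  apply: le_trans_from zt _; rewrite -k1.
  exact: (kle _ _ t01 l01).2 t1.
have [r r01 rz] := kS z zx.
have sr : s <= r by apply: (kle _ _ s01 r01).1; rewrite rz.
have rt : r <= t by apply: (kle _ _ r01 t01).1; rewrite rz.
rewrite -rz; apply: eO; rewrite /ball/= ltr_distlC.
move: rt; rewrite /t le_min => /andP[_ rt].
by apply/andP; split; lra.
Qed.

(** The points not below [x] form an open set, so failing to be below [x] is
    already witnessed strictly before [w]. *)
Lemma not_le_left a p w x : p <=[a] w -> p <> w -> ~ w <=[a] x ->
  exists u, [/\ p <=[a] u, u <=[a] w, u <> w & ~ u <=[a] x].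
Proof.
move=> pw pw' wx.
have wa : w <> a by move=> wa; apply: wx; rewrite wa.
have oO : open [set z | ~ z <=[a] x].
  apply: (@closed_openC _ [set z | z <=[a] x]).
  exact: closed_le_from.
have [u [uw uw' uO]] := near_left wa oO wx.
have [pu|up] := le_total_from pw uw.
  by exists u; split => //; exact: uO.
by exists p; split => //; exact: uO.
Qed.

End RootedOrder.

Notation "x <=[ a ] y" := (le_from a x y).

(** * Minimal closed sets *)

Lemma chain_bigcap_nonempty {X : topologicalType} (F : set (set X)) :
  compact [set: X] -> F !=set0 -> (forall K, F K -> closed K /\ K !=set0) ->
  total_on F subset -> \bigcap_(K in F) K !=set0.
Proof.
move=> cX F0 FK Ft.
have FF : ProperFilter (filter_from F id).
  apply: filter_from_proper; last by move=> K /FK[].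
  apply: filter_from_filter => // K L FKK FL.
  by have [KL|LK] := Ft K L FKK FL; [exists K|exists L] => // x Kx; split => //;
    [exact: KL|exact: LK].
have [|p [_ pF]] := cX (filter_from F id) FF.
  by case: F0 => K FKK; exists K.
exists p => K FKK; have [cK _] := FK _ FKK; apply: cK => U pU.
by apply: pF => //; exists K.
Qed.

(** Zorn's lemma for reverse inclusion: by compactness a chain of nonempty closed
    sets has a nonempty intersection. *)
Lemma exists_minimal_closed {X : topologicalType} (P : set X -> Prop) :
  compact [set: X] -> (exists K, P K) ->
  (forall K, P K -> closed K /\ K !=set0) ->
  (forall F : set (set X), F !=set0 -> F `<=` P ->
    \bigcap_(K in F) K !=set0 -> P (\bigcap_(K in F) K)) ->
  exists K, P K /\ forall L, P L -> L `<=` K -> L = K.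
Proof.
move=> cX [K0 PK0] Pcl Pcap.
pose S := {K : set X | P K}.
pose r (s t : S) := `[< sval t `<=` sval s >].
have [|s t u /asboolP st /asboolP tu|s t /asboolP st /asboolP ts|A At|[K PK] Kmin]
    := @Zorn S r.
- by move=> s; apply/asboolP.
- by apply/asboolP; apply: subset_trans tu st.
- by apply: eq_sig_hprop => [K p q|]; [exact: Prop_irrelevance|apply/seteqP].
- have [[s0 As0]|A0] := pselect (A !=set0); last first.
    by exists (exist _ K0 PK0) => s As; case: A0; exists s.
  pose F := sval @` A.
  have FP : F `<=` P by move=> _ [s _ <-]; exact: svalP.
  have F0 : F !=set0 by exists (sval s0), s0.
  have PF : P (\bigcap_(K in F) K).
    apply: Pcap => //; apply: chain_bigcap_nonempty => //.
      by move=> K /FP; exact: Pcl.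
    move=> _ _ [s As <-] [t At' <-].
    by have [/asboolP st|/asboolP ts] := At s t As At'; [right|left].
  exists (exist _ _ PF) => s As; apply/asboolP => x /=; apply; by exists s.
exists K; split => // L PL LK.
have := Kmin (exist _ L PL); rewrite /r /= => H.
by have [] := H (asboolT LK).
Qed.

Section Maximal.
Context {R : realType} {T : metricType R} (hT : @arc_tree R T).

(** A minimal member of the closed subsets of [M] that are upward closed in [M]
    is reduced to one point, which is maximal. *)
Lemma closed_has_maximal (a : T) (M : set T) : closed M -> M !=set0 ->
  exists2 z, M z & forall y, M y -> z <=[a] y -> y = z.
Proof.
move=> cM [m Mm].
pose P (K : set T) := [/\ closed K, K !=set0, K `<=` M
  & forall x y, K x -> M y -> x <=[a] y -> K y].
have [||F F0 FP F1|K [[cK [z Kz] KM Kup] Kmin]] :=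
  @exists_minimal_closed _ P (tree_compact hT).
- by exists M; split => //; exists m.
- by move=> K [].
- split => //.
  + by apply: closed_bigI => K /FP[].
  + by case: F0 => K FK x Fx; have [_ _ + _] := FP _ FK; apply; exact: Fx.
  + move=> x y Fx My xy K FK; have [_ _ _ Kup] := FP _ FK.
    by apply: Kup xy => //; exact: Fx.
exists z; first exact: KM.
move=> y My zy.
have E : M `&` [set x | y <=[a] x] = K.
  apply: Kmin.
    split.
    - by apply: closedI => //; exact: closed_ge_from.
    - by exists y; split => //; exact: le_refl_from.
    - by move=> x [].
    - by move=> x x' [Mx yx] Mx' xx'; split => //; exact: le_trans_from xx'.
  by move=> x [Mx yx]; apply: (Kup z) => //; exact: le_trans_from yx.
have [_ yz] : (M `&` [set x | y <=[a] x]) z by rewrite E.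
exact: (le_anti_from hT yz zy).
Qed.

End Maximal.

(** * The attracting end *)

Section AttractingEnd.
Context {R : realType} {T : metricType R} (hT : @arc_tree R T).
Implicit Types (a e r u w x y z : T) (O : set T).
Context (f : T -> T) (hf : continuous f).

Lemma iter_continuous n : continuous (iter n f).
Proof.
elim: n => [|n IH] x /=; first exact: cvg_id.
by apply: (@continuous_comp _ _ _ (iter n f) f); [exact: IH|exact: hf].
Qed.

Lemma open_preimage (g : T -> T) O : continuous g -> open O -> open (g @^-1` O).
Proof. by move=> /continuousP; apply. Qed.

(** If [x] is not below [g x], some [u] strictly below [x] is not below [g x],
    and this [u] serves for all points near [x]. *)
Lemma closed_le_image a (g : T -> T) :
  continuous g -> closed [set x | x <=[a] g x].
Proof.
move=> hg; rewrite -[X in closed X]setCK; apply: open_closedC.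
rewrite openE => x /= xfx.
have ax : a <> x by move=> ax; apply: xfx; rewrite -ax; exact: ge_root.
have [u [_ ux ux' ufx]] := not_le_left hT (@ge_root _ _ a x) ax xfx.
have nu : nbhs x [set z | u <=[a] z /\ z <> u].
  apply: open_nbhs_nbhs; split; first exact: open_gt_from.
  by split => //; exact: nesym.
have nf : nbhs x (g @^-1` [set z | ~ u <=[a] z]).
  by apply: hg; apply: open_nbhs_nbhs; split => //; exact: open_not_ge.
apply: filterS2 nu nf => z [uz _] ufz zfz; apply: ufz.
exact: le_trans_from zfz.
Qed.

(** A maximal point of [M] below must be fixed: were it moved, it would be moved
    upwards, and so would the points slightly beyond it, on the way to its
    image. *)
Lemma exists_attracting a :
  exists2 e, f e = e & forall y, y <=[a] e -> y <=[a] f y.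
Proof.
pose M := [set x | forall y, y <=[a] x -> y <=[a] f y].
have cM : closed M.
  rewrite -[X in closed X]setCK; apply: open_closedC.
  rewrite openE => x /= /existsNP[y /not_implyP[yx yfy]].
  have [yx'|yx'] := pselect (y = x).
    have : nbhs x (~` [set x | x <=[a] f x]).
      apply: open_nbhs_nbhs; split; last by rewrite /= -yx'.
      by apply: closed_openC; exact: closed_le_image.
    by apply: filterS => z zfz Mz; apply: zfz; apply: Mz; exact: le_refl_from.
  have : nbhs x [set z | y <=[a] z /\ z <> y].
    apply: open_nbhs_nbhs; split; first exact: open_gt_from.
    by split => //; exact: nesym.
  by apply: filterS => z [yz _] Mz; apply: yfy; exact: Mz.
have [|e Me emax] := closed_has_maximal hT a cM.
  by exists a => y /le_root ->; exact: ge_root.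
exists e => //; apply: contrapT => fe.
have efe : e <=[a] f e by apply: Me; exact: le_refl_from.
(* [u0] is strictly between [e] and its image, so that the points near [e] are
   mapped above [u0], hence above those of them that lie below [u0]. *)
have [u0 [eu0 u0fe u0e /(_ u0) u0fe']] :=
  near_right hT efe (nesym fe) (@open_setC1 _ _ (f e)) (nesym fe).
have u0E : u0 <> f e by apply: u0fe' => //; exact: le_refl_from.
have [|u [eu uu0 ue uO]] := near_right hT eu0 (nesym u0e)
    (open_preimage hf (open_gt_from hT a u0)) _.
  by split => //; exact: nesym.
suff Mu : M u by apply: ue; exact: emax.
move=> y yu; have [ye|ey] := le_total_from hT yu eu; first exact: Me.
have [u0fy _] := uO y ey yu.
by apply: le_trans_from u0fy; exact: le_trans_from uu0.
Qed.

(** If the arcs from [e] to [x] and to [y] had only [e] in common, every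
    connected set containing [x] and [y] would contain both arcs but for [e];
    being closed, the arc from [x] to [y] would then contain [e], which would
    thus separate them. *)
Lemma noncut_common_germ e x y : ~ cut_point e -> x <> e -> y <> e ->
  exists r, [/\ r <> e, r <=[e] x & r <=[e] y].
Proof.
move=> ecut xe ye; apply: contrapT => nr; apply: ecut.
apply: (cut_point_from (nesym xe) ye).
apply: contrapT => exy.
have oO : open [set z | ~ z <=[x] y].
  by apply: (@closed_openC _ [set z | z <=[x] y]); exact: closed_le_from.
have [u [_ ux ue /(_ u) uC]] :=
  near_right hT (@ge_root _ _ e x) (nesym xe) oO exy.
apply: uC; [exact: ge_root|exact: le_refl_from|].
move=> C kC Cx Cy; apply: (connected_cross kC Cx Cy ux) => uy.
by apply: nr; exists u.
Qed.

Lemma noncut_germ e a : ~ cut_point e -> a <> e -> exists r,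
  [/\ r <> e, r <=[e] a, r <> a & forall x, x <=[e] r \/ r <=[e] x].
Proof.
move=> ecut ae.
have [u [_ ua ue /(_ u) uC]] := near_right hT (@ge_root _ _ e a) (nesym ae)
  (@open_setC1 _ _ a) (nesym ae).
have {uC} ua' : u <> a by apply: uC; [exact: ge_root|exact: le_refl_from].
have [l lP] := finite_tops hT e.
have [r [re ru rl]] : exists r, [/\ r <> e, r <=[e] u &
    forall v, v \in l -> v <> e -> r <=[e] v].
  elim: l {lP} => [|v l [r [re ru rl]]].
    by exists u; split => //; exact: le_refl_from.
  have [->|ve] := pselect (v = e).
    exists r; split => // w; rewrite inE => /predU1P[->//|]; exact: rl.
  have [r' [r'e r'r r'v]] := noncut_common_germ ecut re ve.
  exists r'; split => //; first exact: le_trans_from ru.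
  move=> w; rewrite inE => /predU1P[->//|wl we].
  by apply: le_trans_from r'r _; exact: rl.
exists r; split => //; first exact: le_trans_from ua.
  by move=> ra; apply: ua'; apply: (le_anti_from hT ua); rewrite -ra.
move=> x; have [v vl xv] := lP x.
have [ve|ve] := pselect (v = e).
  by left; move: xv; rewrite ve => /le_root ->; exact: ge_root.
exact: le_total_from xv (rl _ vl ve).
Qed.

(** For a tree rooted at an end [e] these are exactly the cut points. *)
Definition inner e x := x <> e /\ exists2 y, y <> x & x <=[e] y.

Lemma inner_cut e x : inner e x -> cut_point x.
Proof. by move=> [xe [y yx xy]]; exact: cut_point_from xy. Qed.

Lemma below_inner e x y : x <> e -> x <=[e] y -> x <> y -> inner e x.
Proof. by move=> xe xy xy'; split => //; exists y => //; exact: nesym. Qed.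

Context (hcut : forall x : T, cut_point x -> ~ periodic_point f x).

(** The direction in which the map moves the points near the attracting end
    propagates: past the first point moved away from the end, or fixed, there
    would be a periodic cut point. *)
Lemma exists_root a : f a <> a -> exists e,
  [/\ forall O, open O -> O e -> exists V,
        [/\ open V, V e, V `<=` O & forall x, V x -> V (f x)],
      f e = e &
      forall y n, inner e y -> (0 < n)%N -> ~ y <=[e] iter n f y].
Proof.
move=> fa; have [e fe eM] := exists_attracting a.
have ae : a <> e by move=> ae; apply: fa; rewrite ae.
exists e.
have ecut : ~ cut_point e by move=> /hcut; apply; exists 1%N.
have [r [re ra ra' rcmp]] := noncut_germ ecut ae.
(* A point [y] near [e] mapped above itself would force points [u] just before
   it to be mapped above [y] as well; seen from [a], these [u] would then
   separate two points of the connected set of points above [y]. *)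
have down y : y <> e -> y <=[e] r -> ~ y <=[e] f y.
  move=> ye yr yfy.
  have ya : y <=[e] a by exact: le_trans_from ra.
  have ya' : y <> a.
    by move=> ya'; apply: ra'; apply: (le_anti_from hT ra); rewrite -ya'.
  have fyy : f y <> y.
    by move=> E; apply: (hcut (cut_point_from ye (nesym ya') ya)); exists 1%N.
  have [|u [uy uy' uO]] := near_left hT ye
      (open_preimage hf (open_gt_from hT e y)) _; first by [].
  have [yfu _] := uO u (@le_refl_from _ _ e u) uy.
  apply: uy'; apply: (le_anti_from hT uy).
  have ufu : u <=[a] f u.
    by apply: eM; apply: le_from_sym; exact: le_trans_from ya.
  by apply: (ufu [set z | y <=[e] z]) => //; exact: ge_connected.
have step y : y <=[e] r -> f y <=[e] y.
  move=> yr; have [->|ye] := pselect (y = e); first by rewrite fe; exact: ge_root.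
  have nyfy := down y ye yr.
  have [fyr|rfy] := rcmp (f y).
    by have [|//] := le_total_from hT yr fyr.
  by case: nyfy; exact: le_trans_from rfy.
have iterdown y n : y <=[e] r -> iter n f y <=[e] y.
  move=> yr; elim: n => [|n IH]; first exact: le_refl_from.
  rewrite iterS; apply: (le_trans_from _ IH); apply: step.
  exact: le_trans_from yr.
have near y n : y <> e -> y <=[e] r -> (0 < n)%N -> ~ y <=[e] iter n f y.
  case: n => // n ye yr _; rewrite iterSr => yn.
  apply: (down y ye yr); apply: le_trans_from yn _; apply: iterdown.
  exact: le_trans_from (step y yr) yr.
split=> //.
- move=> O oO Oe.
  have [u [_ ur ue uO]] := near_right hT (@ge_root _ _ e r) (nesym re) oO Oe.
  have Vr x : ~ u <=[e] x -> x <=[e] r.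
    move=> ux; have [//|rx] := rcmp x.
    by case: ux; exact: le_trans_from rx.
  exists [set x | ~ u <=[e] x]; split.
  + exact: open_not_ge.
  + by move=> /le_root.
  + move=> x /= ux; have [xu|//] := le_total_from hT (Vr x ux) ur.
    by apply: uO => //; exact: ge_root.
  + by move=> x /= ux ufx; exact: ux (le_trans_from ufx (step x (Vr x ux))).
move=> y n yi n0 yg; set g := iter n f in yg.
have hg : continuous g by exact: iter_continuous.
have [ye _] := yi.
have [yr|ry] := rcmp y; first exact: (near y n).
have [k [kc k0 k1 kle kS]] := arc_param hT (nesym ye).
have [s0 s01 s0r] := kS r ry.
have cA : closed [set t | k t <=[e] g (k t)].
  apply: (@preimage_closed _ _ k [set x | x <=[e] g x]).
    by move=> t _; exact: kc.
  exact: closed_le_image.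
(* [k m] is the first point from [r] on that is below its image. *)
have [||m [sm m1 mA mmin]] := closed_min_seg (u := s0) (v := 1) cA.
- by rewrite /= k1.
- by case/andP: s01.
have m01 : 0 <= m <= 1.
  by rewrite m1 andbT; case/andP: s01 => s00 _; exact: le_trans sm.
have l01 : (0 : R) <= (1 : R) <= (1 : R) by rewrite ler01 lexx.
have rz : r <=[e] k m by rewrite -s0r; exact: (kle _ _ s01 m01).2 sm.
have zy : k m <=[e] y by rewrite -k1; exact: (kle _ _ m01 l01).2 m1.
have ze : k m <> e by move=> E; apply: re; apply: le_root; rewrite -{2}E.
have rz' : r <> k m.
  move=> E; apply: (near r n re _ n0); first exact: le_refl_from.
  by rewrite E.
have zcut : cut_point (k m).
  have [->|zy'] := pselect (k m = y); first exact: inner_cut yi.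
  exact: inner_cut (below_inner ze zy zy').
have gz : g (k m) <> k m by move=> E; apply: (hcut zcut); exists n.
have [//|u [uz uz' uO]] := near_left hT ze
    (open_preimage hg (open_gt_from hT e (k m))) _.
have [u' [ru' u'z u'z' zgu']] : exists u', [/\ r <=[e] u', u' <=[e] k m,
    u' <> k m & k m <=[e] g u'].
  have [ru|ur] := le_total_from hT rz uz.
    by exists u; split => //; have [] := uO u (@le_refl_from _ _ e u) uz.
  by exists r; split => //; have [] := uO r ur rz.
have [s s01' su'] := kS u' (le_trans_from u'z zy).
apply: u'z'; apply: (le_anti_from hT u'z); rewrite -su'.
apply: (kle _ _ m01 s01').2; apply: mmin.
  by apply: (kle _ _ s01 s01').1; rewrite s0r su'.
by rewrite /= su'; exact: le_trans_from zgu'.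
Qed.

End AttractingEnd.

(** * Orbits of points *)

Section Orbits.
Context {R : realType} {T : metricType R} (hT : @arc_tree R T).
Implicit Types (e r u w x y z : T) (O K : set T).

Section OmegaLimit.
Context (f : T -> T) (hf : continuous f).

Definition omega_limit x := [set z | forall U : set T, nbhs (z : T) U ->
  forall n, exists2 m, (n < m)%N & U (iter m f x)].

Lemma omega_limit_closed x : closed (omega_limit x).
Proof.
move=> z zcl U; rewrite nbhsE => -[V [oV Vz] VU] n.
have [y [yx Vy]] := zcl V (open_nbhs_nbhs (conj oV Vz)).
have [m nm Vm] := yx V (open_nbhs_nbhs (conj oV Vy)) n.
by exists m => //; exact: VU.
Qed.

Lemma omega_limit_nonempty x : omega_limit x !=set0.
Proof.
have [|z [_ zcl]] := tree_compact hT (F := (fun n => iter n f x) @ \oo) _.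
  exact: filterT.
exists z => U zU n.
have [|_ [[m nm <-] Um]] :=
  zcl ((fun m => iter m f x) @` [set m | (n < m)%N]) U _ zU.
  by exists n.+1 => // m /= nm; exists m.
by exists m.
Qed.

Lemma omega_limit_invariant x z : omega_limit x z -> omega_limit x (f z).
Proof.
move=> xz U Ufz n; have [m nm Um] := xz (f @^-1` U) (hf Ufz) n.
by exists m.+1 => //; exact: ltnW.
Qed.

Lemma omega_limit_sub K x N : closed K ->
  (forall n, (N <= n)%N -> K (iter n f x)) -> omega_limit x `<=` K.
Proof.
move=> cK Kx z xz; apply: cK => U zU.
have [m Nm Um] := xz U zU N.
by exists (iter m f x); split => //; apply: Kx; exact: ltnW.
Qed.

(** A sequence that never climbs back above one of its terms accumulates from
    the far side only. *)
Lemma omega_limit_below e x z :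
  (forall n m, (n < m)%N -> ~ iter n f x <=[e] iter m f x) ->
  omega_limit x z -> exists2 n, z <=[e] iter n f x & iter n f x <> z.
Proof.
move=> xbad xz; apply: contrapT => nz.
have zx n : z <=[e] iter n f x -> iter n f x = z.
  by move=> zxn; apply: contrapT => xnz; apply: nz; exists n.
have [l lP] := finite_tops hT e.
have Nz : \forall p \near z, forall v, v \in l -> p <=[e] v -> z <=[e] v.
  elim: l {lP} => [|v l IH]; first by apply: nearW.
  have nv : \forall p \near z, p <=[e] v -> z <=[e] v.
    have [zv|zv] := pselect (z <=[e] v); first by apply: nearW.
    have : nbhs z (~` [set p | p <=[e] v]).
      apply: open_nbhs_nbhs; split => //.
      by apply: closed_openC; exact: closed_le_from.
    by apply: filterS => p /[apply].
  apply: filterS2 IH nv => p IH pv w; rewrite inE => /predU1P[->//|]; exact: IH.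
have below n : (forall v, v \in l -> iter n f x <=[e] v -> z <=[e] v) ->
    iter n f x <=[e] z.
  move=> H; have [v vl xv] := lP (iter n f x).
  have [//|/zx ->] := le_total_from hT xv (H v vl xv); exact: le_refl_from.
(* Two terms near [z] are below it, and one of them differs from [z]. *)
have [n _ /below nz'] := xz _ Nz 0%N.
have [m nm /below mz] := xz _ Nz n.
have [k [kz kz']] : exists k, iter k f x <=[e] z /\ iter k f x <> z.
  have [E|] := pselect (iter n f x = z); last by exists n.
  by exists m; split => // E'; apply: (xbad _ _ nm); rewrite E E'; exact: le_refl_from.
have gtz : nbhs z [set p | iter k f x <=[e] p /\ p <> iter k f x].
  by apply: open_nbhs_nbhs; split; [exact: open_gt_from|split => //; exact: nesym].
have [i ki [xki _]] := xz _ gtz k.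
exact: (xbad _ _ ki).
Qed.

Context (e : T)
  (hstar : forall y n, inner e y -> (0 < n)%N -> ~ y <=[e] iter n f y).

Lemma periodic_maximal w :
  w <> e -> periodic_point f w -> forall z, w <=[e] z -> z = w.
Proof.
move=> we [k [k0 kw]] z wz; apply: contrapT => zw.
apply: (hstar (y := w) (n := k)) => //; first by split=> //; exists z.
by rewrite kw; exact: le_refl_from.
Qed.

Lemma iter_star x : (forall n, inner e (iter n f x)) ->
  forall n m, (n < m)%N -> ~ iter n f x <=[e] iter m f x.
Proof.
move=> xi n m nm; rewrite -(subnK (ltnW nm)) iterD; apply: hstar => //.
by rewrite subn_gt0.
Qed.

(** A maximal point of a minimal set would be recurrent, hence would be
    approached by its own orbit from the far side. *)
Lemma inner_orbit_reaches x O : open O -> O e ->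
  (forall n, inner e (iter n f x)) -> exists n, O (iter n f x).
Proof.
move=> oO Oe xi; apply: contrapT => nO.
have omO z : omega_limit x z -> ~ O z.
  have := @omega_limit_sub (~` O) x 0 (open_closedC oO) => H; apply: H.
  by move=> n _ On; apply: nO; exists n.
have omi z : omega_limit x z -> inner e z.
  move=> xz; have [n zn nz] := omega_limit_below (iter_star xi) xz.
  apply: below_inner zn _; last exact: nesym.
  by move=> ze; apply: (omO z xz); rewrite ze.
pose P K := [/\ closed K, K !=set0, K `<=` omega_limit x &
  forall z, K z -> K (f z)].
have [|||K [[cK K0 Kx Kf] Kmin]] := exists_minimal_closed (P := P) (tree_compact hT).
- exists (omega_limit x); split => //; first exact: omega_limit_closed.
    exact: omega_limit_nonempty.
  exact: omega_limit_invariant.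
- by move=> K [].
- move=> F [K0 FK0] FP F1; split => //.
  + by apply: closed_bigI => K /FP[].
  + by move=> z Fz; have [_ _ + _] := FP _ FK0; apply; exact: Fz.
  + by move=> z Fz K FK; have [_ _ _] := FP _ FK; apply; exact: Fz.
have [z Kz zmax] := closed_has_maximal hT e cK K0.
have Kzn n : K (iter n f z) by elim: n => //= n; exact: Kf.
have zK : omega_limit z `<=` K by apply: (omega_limit_sub (N := 0)).
have E : omega_limit z = K.
  apply: Kmin => //; split.
  - exact: omega_limit_closed.
  - exact: omega_limit_nonempty.
  - by apply: subset_trans zK Kx.
  - exact: omega_limit_invariant.
have zz : omega_limit z z by rewrite E.
have [n zn] := omega_limit_below (iter_star (fun n => omi _ (Kx _ (Kzn n)))) zz.
by apply; exact: zmax.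
Qed.

Lemma orbit_reaches x O : open O -> O e ->
  (exists n, O (iter n f x)) \/ exists n, periodic_point f (iter n f x).
Proof.
move=> oO Oe; have [|np] := pselect (exists n, periodic_point f (iter n f x)).
  by right.
left; apply: contrapT => nO.
have [l lP] := finite_tops hT e.
have inj n m : (n < m)%N -> iter m f x <> iter n f x.
  move=> nm E; apply: np; exists n, (m - n)%N; split; first by rewrite subn_gt0.
  by rewrite -iterD subnK ?(ltnW nm).
have [N HN] : exists N, forall n, (N <= n)%N -> iter n f x \notin l.
  elim: l {lP} => [|v l [N HN]]; first by exists 0%N.
  have [[n0 n0v]|nv] := pselect (exists n0, iter n0 f x = v).
    exists (maxn N n0.+1) => n; rewrite geq_max => /andP[Nn n0n].
    rewrite inE negb_or HN// andbT; apply/eqP; rewrite -n0v.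
    exact: inj.
  exists N => n Nn; rewrite inE negb_or HN// andbT.
  by apply/eqP => nv'; apply: nv; exists n.
have [n On] : exists n, O (iter n f (iter N f x)).
  apply: inner_orbit_reaches => // n; rewrite -iterD; split.
    by move=> E; apply: nO; exists (n + N)%N; rewrite E.
  apply: contrapT => nmax.
  have [v vl xv] := lP (iter (n + N) f x).
  have /negP := HN (n + N)%N (leq_addl _ _); apply.
  suff -> : iter (n + N) f x = v by [].
  by apply: contrapT => vx; apply: nmax; exists v => //; exact: nesym.
by apply: nO; exists (n + N)%N; rewrite iterD.
Qed.

(** The periodic points other than the root are maximal, hence finitely
    many. *)
Lemma exists_common_period : exists2 p, (0 < p)%N &
  forall w, w <> e -> periodic_point f w -> iter p f w = w.
Proof.
have [l lP] := finite_tops hT e.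
have [p p0 pl] : exists2 p, (0 < p)%N &
    forall w, w \in l -> periodic_point f w -> iter p f w = w.
  elim: l {lP} => [|v l [p p0 pl]]; first by exists 1%N.
  have [[k [k0 kv]]|nv] := pselect (periodic_point f v); last first.
    exists p => // w; rewrite inE => /predU1P[->//|]; exact: pl.
  exists (p * k)%N => [|w]; first by rewrite muln_gt0 p0.
  rewrite inE => /predU1P[-> _|wl wp]; first by rewrite iterM iter_fix.
  by rewrite mulnC iterM iter_fix// pl.
exists p => // w we wp; apply: pl => //.
by have [v vl wv] := lP w; rewrite -(periodic_maximal we wp wv).
Qed.

End OmegaLimit.

(** Near a fixed end other than the root the points move towards the root, so
    that the image of a small arc ending there covers the arc. *)
Lemma expanding_end (g : T -> T) e w : continuous g ->
  (forall y, inner e y -> ~ y <=[e] g y) -> w <> e -> g w = w ->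
  exists t, [/\ t <=[e] w, t <> w, forall x, t <=[e] x -> x <=[e] w &
    forall y u, t <=[e] y -> y <> w -> y <=[e] u ->
      exists2 x, y <=[e] x & g x = u].
Proof.
move=> hg gstar we gw.
have wmax z : w <=[e] z -> z = w.
  move=> wz; apply: contrapT => zw; apply: (gstar w).
    by split => //; exists z.
  by rewrite gw; exact: le_refl_from.
have [l lP] := finite_tops hT e.
have [t0 [t0w t0w' t0l]] : exists t, [/\ t <=[e] w, t <> w &
    forall v, v \in l -> t <=[e] v -> w <=[e] v].
  elim: l {lP} => [|v l [t [tw tw' tl]]].
    by exists e; split => //; exact: nesym.
  have [wv|wv] := pselect (w <=[e] v).
    exists t; split => // v'; rewrite inE => /predU1P[->//|]; exact: tl.
  have [u [tu uw uw' uv]] := not_le_left hT tw tw' wv.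
  exists u; split => // v'; rewrite inE => /predU1P[->//|v'l uv'].
  by apply: tl => //; exact: le_trans_from uv'.
have t0end x : t0 <=[e] x -> x <=[e] w.
  move=> t0x; have [v vl xv] := lP x.
  by rewrite -(wmax v)//; apply: t0l => //; exact: le_trans_from xv.
pose O := g @^-1` [set z | t0 <=[e] z /\ z <> t0] `&` ~` [set e].
have oO : open O.
  apply: openI; last exact: open_setC1.
  by apply: open_preimage => //; exact: open_gt_from.
have Ow : O w by split => //=; rewrite gw; split => //; exact: nesym.
have [u [uw uw' uO]] := near_left hT we oO Ow.
have [t [t0t ut tw tw']] : exists t, [/\ t0 <=[e] t, u <=[e] t, t <=[e] w & t <> w].
  have [t0u|ut0] := le_total_from hT t0w uw.
    by exists u; split => //; exact: le_refl_from.
  by exists t0; split => //; exact: le_refl_from.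
exists t; split => // [x tx|y z ty yw yz].
  by apply: t0end; exact: le_trans_from tx.
have zw : z <=[e] w.
  by apply: t0end; apply: le_trans_from yz; exact: le_trans_from ty.
have yw' : y <=[e] w by exact: le_trans_from zw.
have [[t0gy _] ye] := uO y (le_trans_from ut ty) yw'.
have nygy : ~ y <=[e] g y by apply: gstar; exact: below_inner yw' yw.
have kC : connected (g @` [set x | y <=[e] x]).
  apply: connected_continuous_connected; first exact: ge_connected.
  exact: continuous_subspaceT.
have [|||x yx gx] := @connected_cross _ _ e _ w (g y) z kC _ _ zw.
- by exists w.
- by exists y => //; exact: le_refl_from.
- by move=> zgy; apply: nygy; exact: le_trans_from zgy.
by exists x.
Qed.

End Orbits.

(** * Limits of continua *)

Section HausdorffLimit.
Context {R : realType} {T : metricType R} (cT : compact [set: T]).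
Implicit Types (x y z : T) (O U : set T) (K : nat -> Con T).

Definition lower_limit K := [set x | forall U : set T, nbhs (x : T) U ->
  \forall n \near \oo, (K n : set T) `&` U !=set0].

Lemma lower_limit_closed K : closed (lower_limit K).
Proof.
move=> z zcl U; rewrite nbhsE => -[V [oV Vz] VU].
have [y [yK Vy]] := zcl V (open_nbhs_nbhs (conj oV Vz)).
have := yK V (open_nbhs_nbhs (conj oV Vy)); apply: filterS => n.
by move=> [x [Kx Vx]]; exists x; split => //; exact: VU.
Qed.

Lemma disjoint_open_separated (U V : set T) : open U -> open V ->
  U `&` V = set0 -> separated U V.
Proof.
move=> oU oV UV; split; apply/seteqP; split => x //= -[].
  move=> Ux Vx; have [y UVy] := Ux V (open_nbhs_nbhs (conj oV Vx)).
  by rewrite UV in UVy.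
move=> Ux Vx; have [y [Vy Uy]] := Vx U (open_nbhs_nbhs (conj oU Ux)).
by have : (U `&` V) y by []; rewrite UV.
Qed.

Section Converges.
Context (K : nat -> Con T).
Context (L0 : lower_limit K !=set0).
Context (LK : forall O, open O -> lower_limit K `<=` O ->
  \forall n \near \oo, (K n : set T) `<=` O).

(** A separation of the limit by disjoint open sets would separate the continua
    [K n] for [n] large. *)
Lemma lower_limit_connected : connected (lower_limit K).
Proof.
move=> B [x Bx] [C oC BC] [D cD BD].
apply/seteqP; split=> [y|y Ly]; first by rewrite BC => -[].
apply: contrapT => By.
have cL := @lower_limit_closed K.
have nT : normal_space T by apply: compact_normal => //; exact: metric_hausdorff.
have [|||U [V [oU oV BU BV UV]]] :=
    (@normal_openP R T).1 nT B (lower_limit K `&` ~` C).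
- by rewrite BD; exact: closedI.
- by apply: closedI => //; exact: open_closedC.
- by apply/seteqP; split => z //=; rewrite BC => -[[_ Cz] [_ /(_ Cz)]].
have LUV : lower_limit K `<=` U `|` V.
  move=> z Lz; have [Cz|Cz] := pselect (C z); [left|right].
    by apply: BU; rewrite BC.
  by apply: BV.
have Ux : nbhs x U by apply: open_nbhs_nbhs; split => //; exact: BU.
have Vy : nbhs y V.
  apply: open_nbhs_nbhs; split => //; apply: BV; split => //.
  by move=> Cy; apply: By; rewrite BC.
have Lx : lower_limit K x by move: Bx; rewrite BC => -[].
near \oo => n.
have Kn : K n `<=` U `|` V by near: n; exact: LK (openU oU oV) LUV.
have [p [Kp Up]] : (K n : set T) `&` U !=set0 by near: n; exact: Lx.
have [q [Kq Vq]] : (K n : set T) `&` V !=set0 by near: n; exact: Ly.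
have [_ _ kK] := con_continuum (K n).
have [KU|KV] := connected_subset (disjoint_open_separated oU oV UV) Kn kK.
- have : (U `&` V) q by split => //; exact: KU.
  by rewrite UV.
- have : (U `&` V) p by split => //; exact: KV.
  by rewrite UV.
Unshelve. all: by end_near. Qed.

Lemma lower_limit_continuum : continuum (lower_limit K).
Proof.
split => //; last exact: lower_limit_connected.
by apply: (subclosed_compact (@lower_limit_closed K) cT).
Qed.

(** Being eventually in each neighbourhood of the lower limit is the other half
    of Hausdorff convergence; compactness of the limit gives uniformity. *)
Lemma cvg_lower_limit : exists B : Con T, K n @[n --> \oo] --> B.
Proof.
exists (MkCon lower_limit_continuum); apply/cvg_ballP => eps eps0.
have e2 : 0 < eps / 2 by rewrite divr_gt0.
have e4 : 0 < eps / 4 by rewrite divr_gt0.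
have [_ cL _] := lower_limit_continuum.
have LKn : \forall n \near \oo,
    lower_limit K `<=` thickening (K n) (eps / 2).
  move/compact_near_coveringP: cL => /(_ _ \oo
    (fun n x => thickening (K n) (eps / 2) x)); apply => x Lx.
  have near_n := Lx _ (nbhsx_ballx x (eps / 4) e4).
  exists (ball x (eps / 4), [set n | (K n : set T) `&` ball x (eps / 4) !=set0]).
    by split => //; exact: nbhsx_ballx.
  move=> [x' n] /= [xx' [y [Ky xy]]]; exists y => //.
  have -> : eps / 2 = eps / 4 + eps / 4 by lra.
  exact: ball_triangle (ball_sym xy) xx'.
have KnL : \forall n \near \oo,
    (K n : set T) `<=` thickening (lower_limit K) (eps / 2).
  have := @LK (\bigcup_(x in lower_limit K) (ball x (eps / 2))^°).
  have oO : open (\bigcup_(x in lower_limit K) (ball x (eps / 2))^°).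
    by apply: bigcup_open => x _; exact: open_interior.
  move=> /(_ oO); have LO : lower_limit K `<=`
      \bigcup_(x in lower_limit K) (ball x (eps / 2))^°.
    by move=> x Lx; exists x => //; exact: nbhsx_ballx.
  move=> /(_ LO); apply: filterS => n Kn x /Kn[y Ly xy].
  by exists y => //; exact: interior_subset xy.
apply: filterS2 LKn KnL => n Ln nL; rewrite ballEmdist /=.
apply: (@le_lt_trans _ _ (eps / 2)); last by lra.
by apply: hausdorff_dist_le; split.
Qed.

End Converges.
End HausdorffLimit.

(** * Orbits of continua *)

Section Dynamics.
Context {R : realType} {T : metricType R} (hT : @arc_tree R T).
Context (f : T -> T) (hf : continuous f) (e : T).
Context (hnear : forall O : set T, open O -> O e -> exists V,
  [/\ open V, V e, V `<=` O & forall x, V x -> V (f x)]).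
Context (hstar : forall y n, inner e y -> (0 < n)%N -> ~ y <=[e] iter n f y).
Context (p : nat) (p0 : (0 < p)%N).
Context (hp : forall w, w <> e -> periodic_point f w -> iter p f w = w).

Local Notation g := (iter p f).

(** In the first case the same [j] serves for all points near [a], because [e]
    has arbitrarily small forward invariant neighbourhoods. *)
Lemma orbit_dichotomy a (O : set T) : open O -> O e ->
  (exists j, \forall a' \near a, forall n, (j <= n)%N -> O (iter n g a')) \/
  exists j w, [/\ w <> e, g w = w & iter j g a = w].
Proof.
move=> oO Oe; have [V [oV Ve VO Vf]] := hnear oO Oe.
have Vit n x : V x -> V (iter n f x) by move=> Vx; elim: n => //= n; exact: Vf.
have first_case n : V (iter n f a) ->
    exists j, \forall a' \near a, forall n, (j <= n)%N -> O (iter n g a').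
  move=> Va; exists n.
  have : nbhs a (iter n f @^-1` V).
    apply: open_nbhs_nbhs; split => //.
    by apply: open_preimage => //; exact: iter_continuous.
  apply: filterS => a' Va' m nm; apply: VO; rewrite -iterM.
  have nmp : (n <= m * p)%N by rewrite (leq_trans nm)// leq_pmulr.
  by rewrite -(subnK nmp) iterD; exact: Vit.
have [[n Va]|[n [k [k0 nk]]]] := orbit_reaches hT hf hstar a oV Ve.
  by left; exact: (first_case n).
have [we|we] := pselect (iter (n * p) f a = e).
  by left; apply: (first_case (n * p)%N); rewrite we.
right; exists n, (iter (n * p) f a); split => //; last by rewrite iterM.
apply: hp => //; exists k; split => //.
have np : (n <= n * p)%N by rewrite leq_pmulr.
by rewrite -(subnK np) iterD -iterD addnC iterD nk.
Qed.

Context (A : Con T).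
Let cg : continuous g := @iter_continuous R T f hf p.
Let K n : Con T := con_iter cg n A.

Lemma lower_limit_fixed j a w : con_set A a -> iter j g a = w -> g w = w ->
  lower_limit K w.
Proof.
move=> Aa aw gw U wU; exists j => // n /= jn; exists w; split.
  exists a => //; rewrite -(subnK jn) iterD aw; exact: iter_fix.
exact: nbhs_singleton.
Qed.

Lemma lower_limit_root a : con_set A a ->
  ~ (exists j w, [/\ w <> e, g w = w & iter j g a = w]) -> lower_limit K e.
Proof.
move=> Aa nw U eU; move: (eU); rewrite nbhsE => -[V [oV Ve] VU].
have [[j /nbhs_singleton aj]|//] := orbit_dichotomy a oV Ve.
exists j => // n /= jn; exists (iter n g a); split; first by exists a.
by apply: VU; exact: aj.
Qed.

(** If [g] maps [E] over itself, the images of [E] increase, and each of them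
    lies in all later images of [A]. *)
Lemma lower_limit_self_covering j (E : set T) : E `<=` K j -> E `<=` g @` E ->
  forall m, iter m g @` E `<=` lower_limit K.
Proof.
move=> EK Eg m x [y Ey <-] U xU; exists (j + m)%N => // n /= jmn.
exists (iter m g y); split; last exact: nbhs_singleton.
have Eit i : E `<=` iter i g @` E.
  elim: i => [|i IH] z Ez; first by exists z.
  have [z' Ez' <-] := IH _ Ez; have [z'' Ez'' <-] := Eg _ Ez'.
  by exists z'' => //; rewrite iterSr.
have [y' Ey' <-] := Eit (n - (j + m))%N y Ey.
have [a Aa <-] := EK _ Ey'.
exists a => //; rewrite -!iterD; congr (iter _ g a).
by rewrite -addnA addnCA (addnC m) subnK.
Qed.

(** Near a point of [A] the orbits either converge to [e] together, or pass near
    a fixed end [w] whose small neighbourhoods map over themselves and so have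
    all their images in the lower limit. *)
Lemma lower_limit_attracts (O : set T) : open O -> lower_limit K `<=` O ->
  \forall n \near \oo, (K n : set T) `<=` O.
Proof.
move=> oO LO.
suff : \forall n \near \oo, (A : set T) `<=` [set a | O (iter n g a)].
  by apply: filterS => n AO _ [a Aa <-]; exact: AO.
have [_ cA kA] := con_continuum A.
have [_ near_cov] := near_covering_withinP A.
move/compact_near_coveringP/near_cov: cA => /(_ _ \oo
  (fun n a => O (iter n g a))); apply => a Aa.
have use j :
    (\forall a' \near a, forall n, (j <= n)%N -> con_set A a' ->
      O (iter n g a')) ->
    \forall a' \near a & n \near \oo, con_set A a' -> O (iter n g a').
  move=> aj.
  exists ([set a' | forall n, (j <= n)%N -> con_set A a' -> O (iter n g a')],
      [set n | (j <= n)%N]).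
    by split => //; exists j.
  by move=> [a' n] /= [H jn]; exact: H.
have [[j [w [we gw jw]]]|nw] :=
  pselect (exists j w, [/\ w <> e, g w = w & iter j g a = w]); last first.
  have Le := lower_limit_root Aa nw.
  have [[j aj]|//] := orbit_dichotomy a oO (LO _ Le).
  by apply: (use j); apply: filterS aj => a' H n jn _; exact: H.
have [Kw|/existsNP[c /not_implyP[Kc cw]]] :=
    pselect (forall c, (K j : set T) c -> c = w).
  apply: (use j); apply: nearW => a' n jn Aa'.
  have -> : iter n g a' = w.
    rewrite -(subnK jn) iterD (Kw (iter j g a')); last by exists a'.
    exact: iter_fix.
  by apply: LO; exact: lower_limit_fixed jw gw.
have gstar y : inner e y -> ~ y <=[e] g y by move=> yi; exact: hstar.
have [t [tw tw' tend tcov]] := expanding_end hT cg gstar we gw.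
have wc : ~ w <=[e] c.
  move=> wc; apply: cw; apply: (periodic_maximal hstar we _ wc).
  by exists p; split.
have [u [tu uw uw' uc]] := not_le_left hT tw tw' wc.
have Kw : (K j : set T) w by exists a.
have uK : [set x | u <=[e] x] `<=` K j.
  move=> x ux; have [_ _ kK] := con_continuum (K j).
  apply: (connected_cross kK Kw Kc).
    by apply: tend; exact: le_trans_from ux.
  by move=> xc; apply: uc; exact: le_trans_from xc.
have ug : [set x | u <=[e] x] `<=` g @` [set x | u <=[e] x].
  by move=> x ux; have [z uz zx] := tcov u x tu uw' ux; exists z.
have uL := lower_limit_self_covering uK ug.
apply: (use j).
have gtw : nbhs a (iter j g @^-1` [set x | u <=[e] x /\ x <> u]).
  apply: open_nbhs_nbhs; split; last by rewrite /= jw; split => //; exact: nesym.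
  apply: open_preimage; first exact: iter_continuous.
  exact: open_gt_from.
apply: filterS gtw => a' [ua' _] n jn Aa'.
apply: LO; apply: (uL (n - j)%N); exists (iter j g a') => //.
by rewrite -iterD subnK.
Qed.

Lemma lower_limit_nonempty : lower_limit K !=set0.
Proof.
have [[a Aa] _ _] := con_continuum A.
have [[j [w [we gw jw]]]|nw] :=
  pselect (exists j w, [/\ w <> e, g w = w & iter j g a = w]).
  by exists w; exact: lower_limit_fixed jw gw.
by exists e; exact: lower_limit_root Aa nw.
Qed.

End Dynamics.

Theorem theorem2 (R : realType) (T : metricType R) (f : T -> T)
    (hT : tree T) (hf : continuous f)
    (hcut : forall x : T, cut_point x -> ~ periodic_point f x) :
  forall A : Con T, asymptotically_periodic hf A.
Proof.
move=> A; have [[a fa]|fid] := pselect (exists a, f a <> a); last first.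
  have fE x : f x = x by apply: contrapT => fx; apply: fid; exists x.
  exists 1%N; split => //; exists A.
  rewrite (_ : (fun n => _) = cst A); first exact: cvg_cst.
  apply/funext => n; apply: con_inj; apply/seteqP; split => x /=.
    by move=> [y Ay <-]; rewrite iter_fix.
  by move=> Ax; exists x => //; rewrite iter_fix.
have aT : @arc_tree R T.
  split; first by have [] := hT.
  by apply: tree_covered => //; exists a, (f a); exact: nesym.
have [e [hnear fe hstar]] := exists_root aT hf hcut fa.
have [p p0 hp] := exists_common_period aT hstar.
exists p; split => //.
have [B BK] := cvg_lower_limit (tree_compact aT)
  (lower_limit_nonempty aT hf hnear hstar p0 hp A)
  (lower_limit_attracts (hf := hf) aT hnear hstar p0 hp (A := A)).
exists B; rewrite (_ : (fun n => _) =
  (fun n => con_iter (@iter_continuous R T f hf p) n A)) //.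
apply/funext => n; apply: con_inj => /=.
by rewrite mulnC; congr image; apply/funext => x; rewrite iterM.
Qed.
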